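(* Let $n\ge 2$ and let $M \in \mathcal{S}_n$ be a simple minimiser, and let $\mathbf{w}$ be a unit eigenvector of $M$ for the eigenvalue $\lambda_{n-1}(M)$. Then, after applying a common permutation to the rows and columns of $M$ (and the same permutation to the coordinates of $\mathbf{w}$), there are integers $P,N \ge 1$ and $Z \ge 0$ with $P+N+Z=n$ such that \[ M = \begin{pmatrix} O_{P} & J_{P,N} & X \\ J_{N,P} & O_{N} & Y \\ X^T & Y^T & W \end{pmatrix}, \] where $X, Y, W$ are $P\times Z$, $N\times Z$ and $Z\times Z$ matrices with entries in $[0,1]$ satisfying $\frac{1}{\sqrt{P}}X^T\mathbf{j}_P = \frac{1}{\sqrt{N}}Y^T\mathbf{j}_N$; moreover \[ \mathbf{w}^T = \begin{pmatrix} \frac{\mathbf{j}_P^T}{\sqrt{2P}} & -\frac{\mathbf{j}_N^T}{\sqrt{2N}} & \mathbf{0}_{Z}^T \end{pmatrix} \quad\text{and}\quad \lambda_{n-1}(M) = -\sqrt{PN}. \]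
   Context: $\mathcal{S}_n$ is the set of $n\times n$ real symmetric matrices with all entries in $[0,1]$; $\lambda_k(M)$ is the $k$-th largest eigenvalue of $M$ counted with multiplicity. A simple minimiser is a matrix $M\in\mathcal{S}_n$ with $\lambda_n(M) < \lambda_{n-1}(M)$ such that $\lambda_{n-1}(M)\le\lambda_{n-1}(M')$ for all $M'\in\mathcal{S}_n$. $O_m$ is the $m\times m$ zero matrix, $J_{m,l}$ the $m\times l$ all-ones matrix, $\mathbf{j}_m$ the all-ones vector of length $m$ and $\mathbf{0}_m$ the zero vector of length $m$. *)

(* Defs.v *)
From HB Require Import structures.
From mathcomp Require Import all_boot all_order all_fingroup all_algebra.
From mathcomp Require Import reals.
From Stdlib Require Import ClassicalEpsilon.
Set Implicit Arguments. Unset Strict Implicit. Unset Printing Implicit Defensive.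
Import Order.TTheory GRing.Theory Num.Theory.
Local Open Scope ring_scope.

Definition inS (R : realType) (n : nat) (M : 'M[R]_n) : bool :=
  (M^T == M) && [forall i, forall j, (0 <= M i j) && (M i j <= 1)].

Definition is_spectrum (R : realType) (n : nat) (M : 'M[R]_n) (s : seq R) : bool :=
  [&& size s == n, sorted (fun x y => y <= x) s
    & char_poly M == \prod_(x <- s) ('X - x%:P)].

(* lambda k M = the k-th largest eigenvalue of M (k >= 1), counted with
   multiplicity.  For real symmetric matrices such a sorted root list exists
   (and is unique), so the choice below is the intended one. *)
Definition spectrum (R : realType) (n : nat) (M : 'M[R]_n) : seq R :=
  epsilon (inhabits [::]) (fun s => is_spectrum M s).

Definition lambda (R : realType) (n : nat) (k : nat) (M : 'M[R]_n) : R :=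
  nth 0 (spectrum M) k.-1.

Definition simple_minimiser (R : realType) (n : nat) (M : 'M[R]_n) : Prop :=
  [/\ inS M, lambda n M < lambda n.-1 M &
      forall M' : 'M[R]_n, inS M' -> lambda n.-1 M <= lambda n.-1 M'].

(* Main.v *)
(** Let [lambda_n < lambda_(n-1)] be the two smallest eigenvalues of [M], with
    eigenvectors [u] and [w].  If some [M'] in S_n had [w^T M' w < w^T M w], then
    a small step from [M] towards [M'] would push the quadratic form below
    [lambda_(n-1)] on the plane spanned by [u] and [w], hence, by Courant-Fischer,
    lower the second smallest eigenvalue.  So [M] minimises the linear functional
    [M' |-> w^T M' w] over S_n, which forces [M i j = 1] where [w i * w j < 0] and
    [M i j = 0] where [w i * w j > 0].  Comparing with the complete graph (and, for
    [n = 2], with the trace) gives [lambda_(n-1) < 0]; then the eigenvector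
    equation makes [w] constant on the indices of each sign and yields the
    remaining identities. *)
Require Import Defs.
From HB Require Import structures.
From mathcomp Require Import all_boot all_order all_fingroup all_algebra.
From mathcomp Require Import reals.
From mathcomp Require Import spectral complex ring lra zify.
From Stdlib Require Import ClassicalEpsilon.
Set Implicit Arguments. Unset Strict Implicit. Unset Printing Implicit Defensive.
Import Order.TTheory GRing.Theory Num.Theory.
Local Open Scope ring_scope.
Local Open Scope sesquilinear_scope.

(** * Spectral decomposition of real symmetric matrices *)

(** A real symmetric matrix is Hermitian, so its unitary diagonalisation has a real diagonal; only
    [U] stays complex. *)
Lemma symmetric_spectral (R : realType) (n : nat) (M : 'M[R]_n) :
  M^T = M ->
  exists (U : 'M[R[i]]_n) (d : 'rV[R]_n), U \is unitarymx /\
    map_mx (real_complex R) M =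
      U^t* *m diag_mx (map_mx (real_complex R) d) *m U.
Proof.
move=> Msym; set A := map_mx _ M.
have Aherm : A \is hermsymmx.
  apply: realsym_hermsym.
    by apply/is_hermitianmxP; rewrite expr0 scale1r map_mx_id // map_trmx Msym.
  by apply/mxOverP => i j; rewrite mxE complex_real.
have /orthomx_spectralP := hermitian_normalmx Aherm.
have /mxOverP dreal := hermitian_spectral_diag_real Aherm.
rewrite invmx_unitary ?spectral_unitarymx // => AE.
exists (spectralmx A), (map_mx (@complex.Re R) (spectral_diag A)).
split; first exact: spectral_unitarymx.
set d := map_mx _ (map_mx _ _); have -> : d = spectral_diag A; last by [].
by apply/matrixP => i j; rewrite !mxE; apply/RRe_real/dreal.
Qed.

Lemma char_poly_similar (F : fieldType) (n : nat) (U V D : 'M[F]_n) :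
  U *m V = 1%:M -> char_poly (V *m D *m U) = char_poly D.
Proof.
move=> UV; have VU := mulmx1C UV.
have E : char_poly_mx (V *m D *m U) =
    map_mx polyC V *m char_poly_mx D *m map_mx polyC U.
  rewrite /char_poly_mx mulmxBr mulmxBl -!map_mxM; congr (_ - _).
  by rewrite scalar_mxC -mulmxA -map_mxM VU map_mx1 mulmx1.
rewrite /char_poly E !det_mulmx mulrAC -det_mulmx -map_mxM VU.
by rewrite map_mx1 det1 mul1r.
Qed.

Lemma char_poly_spectral (R : realType) (n : nat) (M : 'M[R]_n)
    (U : 'M[R[i]]_n) (d : 'rV[R]_n) :
  U \is unitarymx ->
  map_mx (real_complex R) M = U^t* *m diag_mx (map_mx (real_complex R) d) *m U ->
  char_poly M = \prod_(x <- [seq d 0 i | i <- enum 'I_n]) ('X - x%:P).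
Proof.
move=> Uu ME.
apply: (map_poly_inj (real_complex R)).
rewrite map_char_poly ME map_prod_XsubC big_map big_enum /=.
rewrite char_poly_similar; last exact/unitarymxP.
rewrite char_poly_trig; first by apply: eq_bigr => i _; rewrite !mxE eqxx mulr1n.
by apply: diag_mx_is_trig.
Qed.

(** The sorted diagonal of a diagonalisation witnesses that the choice made in [spectrum] is not
    vacuous. *)
Lemma spectrumP (R : realType) (n : nat) (M : 'M[R]_n) :
  M^T = M -> is_spectrum M (spectrum M).
Proof.
move=> /symmetric_spectral [U [d [Uu ME]]].
apply: (epsilon_spec _ (fun s : seq R => is_true (is_spectrum M s))).
exists (sort (fun x y => y <= x) [seq d 0 i | i <- enum 'I_n]).
apply/and3P; split.
- by rewrite size_sort size_map size_enum_ord.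
- by apply: sort_sorted => x y; apply: le_total.
- rewrite (char_poly_spectral Uu ME); apply/eqP/perm_big.
  by rewrite perm_sym perm_sort.
Qed.

(* The unitary diagonalisation of [M] lives over [R[i]], so the kernel vector in
   [lambda_le] is complex although the form is only bounded on real vectors. *)
Lemma complex_form_le0 (R : realType) (m : nat) (S : 'M[R]_m) (z : 'rV[R[i]]_m) :
  S^T = S -> (forall x : 'rV[R]_m, (x *m S *m x^T) 0 0 <= 0) ->
  (z *m map_mx (real_complex R) S *m z^t*) 0 0 <= 0.
Proof.
move=> Ssym Sneg.
set p := map_mx (@complex.Re R) z; set q := map_mx (@complex.Im R) z.
set f := real_complex R; set iC : R[i] := 'i%C.
have zE : z = map_mx f p + iC *: map_mx f q.
  by apply/matrixP => i j; rewrite !mxE -complexE.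
have zC : z^t* = map_mx f p^T - iC *: map_mx f q^T.
  apply/matrixP => i j; rewrite !mxE; case: (z j i) => a b /=.
  by simpc.
rewrite zC zE !(mulmxDl, mulmxBr).
rewrite -?scalemxAl -?scalemxAr -?scalemxAl -?scalemxAr -!map_mxM.
(* Symmetry of [S] cancels the imaginary cross terms and leaves the sum of the real forms at [p] and
   [q]. *)
have cross : q *m S *m p^T = p *m S *m q^T.
  rewrite [LHS]mx11_scalar -[LHS]tr_scalar_mx -mx11_scalar.
  by rewrite !trmx_mul trmxK Ssym mulmxA.
rewrite cross scalerA -expr2 sqr_i scaleN1r opprB.
rewrite [X in _ + X]addrC addrA addrK -map_mxD mxE lecR mxE.
by have := Sneg p; have := Sneg q; lra.
Qed.

(** * Courant-Fischer bound for the second smallest eigenvalue *)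

(** All entries but the last are at least the one at index [n], hence above [c]. *)
Lemma sorted_count_le1 (R : realType) (n : nat) (s : seq R) (c : R) :
  size s = n.+2 -> sorted (fun x y => y <= x) s -> c < nth 0 s n ->
  (count (fun x => (x <= c)%R) s <= 1)%N.
Proof.
move=> ssz s_sorted c_lt.
rewrite -[s](cat_take_drop n.+1) count_cat.
have -> : count (fun x => x <= c) (take n.+1 s) = 0%N.
  apply/eqP; rewrite -leqn0 leqNgt -has_count.
  apply/negP; case/(has_nthP 0) => i.
  rewrite size_takel ?ssz // ltnS => i_le; rewrite nth_take ?ltnS //.
  apply/negP; rewrite -ltNge (lt_le_trans c_lt) //.
  apply: (sorted_leq_nth (leT := fun x y => y <= x)) => //.
  - by move=> x y z /= yx zx; apply: le_trans yx.
  - by rewrite inE ssz; lia.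
  - by rewrite inE ssz; lia.
by rewrite add0n (leq_trans (count_size _ _)) // size_drop ssz; lia.
Qed.

(** The entries of [d] permute [spectrum M], since both split the same polynomial; so at most one of
    them is [<= c]. If there is none, any index serves as [k]. *)
Lemma spectral_count (R : realType) (n : nat) (M : 'M[R]_n) (d : 'rV[R]_n) c :
  M^T = M -> (1 < n)%N ->
  char_poly M = \prod_(x <- [seq d 0 i | i <- enum 'I_n]) ('X - x%:P) ->
  c < lambda n.-1 M ->
  exists k : 'I_n, forall i, i != k -> c < d 0 i.
Proof.
move=> Msym n1 Md c_lt.
have /and3P [/eqP ssz s_sorted /eqP Ms] := spectrumP Msym.
have s_perm : perm_eq (spectrum M) [seq d 0 i | i <- enum 'I_n].
  by apply: prod_XsubC_eq; rewrite -Ms.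
have : leq (count (fun x => x <= c) [seq d 0 i | i <- enum 'I_n]) 1.
  rewrite -(seq.permP s_perm); apply: (@sorted_count_le1 _ n.-2) => //.
  by rewrite ssz; lia.
rewrite count_map => cnt.
case: (pickP (fun k => d 0 k <= c)) => [k dk|dgt].
  exists k => i ik; rewrite ltNge; apply/negP => di.
  have : leq #|[pred i | d 0 i <= c]| 1.
    by rewrite cardE /enum_mem size_filter -enumT.
  move/card_le1_eqP => /(_ i k di dk) ik'.
  by rewrite ik' eqxx in ik.
by exists (Ordinal (ltnW n1)) => i _; rewrite ltNge dgt.
Qed.

(** If [c < lambda n.-1 M], all but one eigenvalue exceed [c]. The complexified row space of [V] has
    dimension two, so it contains a nonzero vector orthogonal to the exceptional eigenvector, and
    there the form of [M - c] is positive. *)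
Lemma lambda_le (R : realType) (n : nat) (M : 'M[R]_n) (V : 'M[R]_(2, n)) c :
  M^T = M -> (1 < n)%N -> row_free V ->
  (forall a : 'rV_2, (a *m V *m M *m (a *m V)^T) 0 0 <=
                     c * ((a *m V) *m (a *m V)^T) 0 0) ->
  lambda n.-1 M <= c.
Proof.
move=> Msym n1 Vfree form_le; rewrite leNgt; apply/negP => c_lt.
have [U [d [Uu ME]]] := symmetric_spectral Msym.
have [k dk] := spectral_count Msym n1 (char_poly_spectral Uu ME) c_lt.
set f := real_complex R in ME.
(* The rows of [L] are those of [V] in eigenbasis coordinates; column [k] has only two entries, so
   some nonzero [z] kills it. *)
set L := map_mx f V *m U^t*.
have : kermx (col k L) != 0.
  by rewrite kermx_eq0 -row_leq_rank -ltnNge (leq_ltn_trans (rank_leq_col _)).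
case/rowV0Pn => z /sub_kermxP zL z0.
set y := z *m L.
have yk : y 0 k = 0.
  have /matrixP /(_ 0 0) := zL; rewrite mxE [RHS]mxE => zL0.
  by rewrite mxE -[RHS]zL0; apply: eq_bigr => j _; rewrite [in RHS]mxE.
have y0 : y != 0.
  rewrite /y /L mulmxA !mulmx_free_eq0 ?row_free_map //.
  by rewrite row_free_unit unitmx_tr unitarymx_unit.
pose S := V *m (M - c%:M) *m V^T.
have Sle : (z *m map_mx f S *m z^t*) 0 0 <= 0.
  apply: complex_form_le0.
    by rewrite /S !trmx_mul trmxK linearB /= Msym tr_scalar_mx mulmxA.
  move=> a; have := form_le a.
  rewrite /S trmx_mul !(mulmxBr, mulmxBl) !mulmxA mul_mx_scalar -!scalemxAl.
  rewrite -subr_le0 [X in _ -> X <= _]mxE [X in _ -> _ + X <= _]mxE.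
  by rewrite [X in _ -> _ - X <= _]mxE.
suff /(lt_le_trans)/(_ Sle) : 0 < (z *m map_mx f S *m z^t*) 0 0 by rewrite ltxx.
set e := map_mx f (d - const_mx c).
have UU : U^t* *m U = 1%:M by apply/mulmx1C/unitarymxP.
have SE : map_mx f S = L *m diag_mx e *m L^t*.
  have VC : (map_mx f V)^t* = map_mx f V^T.
    by apply/matrixP => i j; rewrite !mxE conj_Creal // complex_real.
  have -> : diag_mx e = diag_mx (map_mx f d) - (f c)%:M.
    by rewrite /e map_mxB linearB /= map_const_mx diag_const_mx.
  rewrite /S /L !map_mxM map_mxB ME map_scalar_mx trmx_mul map_mxM trmxCK VC.
  set D := diag_mx _.
  have -> : U^t* *m D *m U - (f c)%:M = U^t* *m (D - (f c)%:M) *m U.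
    by rewrite mulmxBr mulmxBl scalar_mxC -[X in _ = _ - X]mulmxA UU mulmx1.
  by rewrite !mulmxA.
have -> : z *m map_mx f S *m z^t* = y *m diag_mx e *m y^t*.
  have -> : y^t* = L^t* *m z^t* by rewrite /y trmx_mul map_mxM.
  by rewrite SE /y !mulmxA.
(* The form is now the sum of [e 0 i] times the squared modulus of [y 0 i]; the only weight that may
   fail to be positive, at [k], meets [y 0 k = 0]. *)
rewrite mul_mx_diag mxE.
have /rV0Pn [j yj] := y0.
have jk : j != k by apply: contra_neq yj => ->.
have e_gt i : i != k -> 0 < e 0 i by move=> /dk ?; rewrite !mxE ltcR subr_gt0.
have termE i : (\matrix_(i, j) (y i j * e 0 j)) 0 i * (y^t*) i 0 =
    e 0 i * `|y 0 i| ^+ 2.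
  by rewrite !mxE normCK; ring.
rewrite (bigD1 j) //= ltr_pwDl //.
  by rewrite termE mulr_gt0 ?e_gt // exprn_gt0 // normr_gt0.
apply: sumr_ge0 => i _; rewrite termE.
have [->|/e_gt/ltW ei] := eqVneq i k; first by rewrite yk normr0 expr0n mulr0.
by rewrite mulr_ge0 // exprn_ge0.
Qed.

Lemma lambda_le_pair (R : realType) (n : nat) (M : 'M[R]_n) (u v : 'rV[R]_n) c :
  M^T = M -> (1 < n)%N ->
  (forall a b, a *: u + b *: v = 0 -> a = 0 /\ b = 0) ->
  (forall a b x, x = a *: u + b *: v ->
     (x *m M *m x^T) 0 0 <= c * (x *m x^T) 0 0) ->
  lambda n.-1 M <= c.
Proof.
move=> Msym n1 uv_free form_le.
pose V : 'M[R]_(2, n) := \matrix_(i < 2) (if i == 0 then u else v).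
have VE (a : 'rV_2) : a *m V = a 0 0 *: u + a 0 1 *: v.
  rewrite mulmx_sum_row big_ord_recl big_ord1 !rowK /=.
  by congr (_ + a 0 _ *: v); apply: val_inj.
apply: (@lambda_le _ _ _ V) => //; last by move=> a; apply/form_le/VE.
rewrite -kermx_eq0; apply/rowV0P => a /sub_kermxP.
rewrite VE => /uv_free [a0 a1].
by apply/rowP => i; rewrite mxE; have [->|->] : i = 0 \/ i = 1
  by case: i => [[|[|//]] ?]; [left|right]; apply: val_inj.
Qed.

(** * The set S_n, eigenvectors and the trace *)

Lemma inS_sym (R : realType) (n : nat) (M : 'M[R]_n) : inS M -> M^T = M.
Proof. by case/andP => /eqP. Qed.

Lemma inS_bounds (R : realType) (n : nat) (M : 'M[R]_n) i j :
  inS M -> 0 <= M i j <= 1.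
Proof. by case/andP => _ /forallP /(_ i) /forallP /(_ j). Qed.

Lemma inSP (R : realType) (n : nat) (M : 'M[R]_n) :
  M^T = M -> (forall i j, 0 <= M i j <= 1) -> inS M.
Proof.
move=> Msym M01; rewrite /inS Msym eqxx /=.
by apply/forallP => i; apply/forallP => j.
Qed.

Lemma inS_convex (R : realType) (n : nat) (A B : 'M[R]_n) (t : R) :
  0 <= t <= 1 -> inS A -> inS B -> inS (A + t *: (B - A)).
Proof.
move=> /andP [t0 t1] SA SB; apply: inSP.
  by rewrite linearD linearZ linearB /= !inS_sym.
move=> i j; rewrite !mxE.
have /andP [? ?] := inS_bounds i j SA; have /andP [? ?] := inS_bounds i j SB.
by apply/andP; split; nra.
Qed.

Lemma lambda_eigenvector (R : realType) (n k : nat) (M : 'M[R]_n) :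
  M^T = M -> (k < n)%N ->
  exists2 v : 'rV[R]_n, v *m M = lambda k.+1 M *: v & v != 0.
Proof.
move=> Msym kn; apply/eigenvalueP; rewrite eigenvalue_root_char.
have /and3P [/eqP ssz _ /eqP ->] := spectrumP Msym.
by rewrite root_prod_XsubC mem_nth ?ssz.
Qed.

(** Up to sign, both sides are the subleading coefficient of the characteristic polynomial. *)
Lemma mxtrace_spectrum (R : realType) (n : nat) (M : 'M[R]_n) :
  M^T = M -> (0 < n)%N -> \tr M = \sum_(x <- spectrum M) x.
Proof.
move=> Msym n0; have /and3P [/eqP ssz _ /eqP Ms] := spectrumP Msym.
apply: oppr_inj; rewrite -(char_poly_trace M n0) Ms.
by rewrite -coefPn_prod_XsubC ssz // -lt0n.
Qed.

(** * Negativity of the second smallest eigenvalue *)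

Lemma simple_minimiser_lt0 (R : realType) (n : nat) (M : 'M[R]_n) :
  (1 < n)%N -> simple_minimiser M -> lambda n.-1 M < 0.
Proof.
case: n M => [|[|[|n]]] // M _ [SM lt_lambda min_M].
  (* Size 2: the zero matrix gives [lambda 1 M <= 0], so [lambda 2 M < lambda 1 M] makes the trace
     negative, a contradiction. *)
  have tr_ge0 : 0 <= \tr M.
    by apply: sumr_ge0 => i _; case/andP: (inS_bounds i i SM).
  have Msym := inS_sym SM.
  have lambda0 : lambda 1 (0 : 'M[R]_2) <= 0.
    apply: (@lambda_le_pair _ 2 _ (delta_mx 0 0) (delta_mx 0 1)) => //.
    - by rewrite trmx0.
    - move=> a b /rowP ab; have := ab 0; have := ab 1.
      by rewrite !mxE /= !mulr0 !mulr1 addr0 add0r.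
    - by move=> a b x _; rewrite mulmx0 mul0mx mxE mul0r.
  have := le_trans (min_M 0 _) lambda0.
  have -> : inS (0 : 'M[R]_2).
    by apply: inSP => [|i j]; rewrite ?trmx0 // mxE lexx ler01.
  move=> /(_ isT) /= lambda1_le.
  move: tr_ge0 lt_lambda lambda1_le; rewrite mxtrace_spectrum // /lambda.
  have /and3P [/eqP + _ _] := spectrumP Msym.
  by case: (spectrum M) => [|x [|y [|//]]] //= _; rewrite !big_cons big_nil; lra.
(* Size at least 3: the adjacency matrix [K] of the complete graph acts as -1 on the kernel of [J],
   which contains two independent differences of basis vectors. *)
pose J : 'M[R]_n.+3 := const_mx 1.
pose K : 'M[R]_n.+3 := J - 1%:M.
have SK : inS K.
  apply: inSP => [|i j]; first by rewrite linearB /= trmx_const trmx1.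
  by rewrite !mxE; case: (i == j); rewrite ?subrr ?subr0 ?lexx ?ler01.
pose e (i : nat) : 'rV[R]_n.+3 := delta_mx 0 (inord i).
have eJ i : e i *m J = const_mx 1.
  by rewrite -rowE row_const.
suff : lambda n.+2 K <= -1.
  by move/(le_trans (min_M _ SK))/le_lt_trans; apply; lra.
apply: (@lambda_le_pair _ n.+3 _ (e 0%N - e 1%N) (e 1%N - e 2%N)) => //.
- exact: inS_sym.
(* Coordinate 0 sees only [a], and coordinate 2 only [b]. *)
- move=> a b /rowP ab; have := ab (inord 0); have := ab (inord 2).
  rewrite !mxE /= -!val_eqE /= !inordK //= !subr0 !sub0r !mulr0 !mulr1 addr0 add0r.
  by move=> /eqP; rewrite mulrN1 oppr_eq0 => /eqP.
- move=> a b x xE; rewrite /K mulmxBr mulmx1.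
  have -> : x *m J = 0.
    by rewrite xE mulmxDl -!scalemxAl !mulmxBl !eJ !subrr !scaler0 addr0.
  by rewrite sub0r mulNmx mxE mulN1r.
Qed.

(** * First-order optimality of a simple minimiser *)

Lemma quad_form_ge0 (R : realType) (A B C a b : R) :
  0 <= A -> 0 < C -> B ^+ 2 <= A * C ->
  0 <= A * a ^+ 2 - 2 * B * a * b + C * b ^+ 2.
Proof.
move=> A0 C0 disc; rewrite -(pmulr_rge0 _ C0).
have -> : C * (A * a ^+ 2 - 2 * B * a * b + C * b ^+ 2) =
    (A * C - B ^+ 2) * a ^+ 2 + (C * b - B * a) ^+ 2 by ring.
by rewrite addr_ge0 ?sqr_ge0 // mulr_ge0 ?sqr_ge0 // subr_ge0.
Qed.

(** Divided by [t], the discriminant condition becomes linear: [t * (B ^+ 2 + K * D) <= G * D]. It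
    also yields [0 <= G - t * K], as [D] is positive. *)
Lemma exists_small_step (R : realType) (G D B K : R) :
  0 < G -> 0 < D ->
  exists t, [/\ 0 < t, t <= 1, 0 <= G - t * K &
                (t * B) ^+ 2 <= (G - t * K) * (t * D)].
Proof.
(* The summand [G * D] ensures [t <= 1]; the absolute value allows for either sign of [K]. *)
move=> G0 D0; pose den := G * D + B ^+ 2 + `|K| * D.
have GD : 0 < G * D by rewrite mulr_gt0.
have B0 : 0 <= B ^+ 2 by apply: sqr_ge0.
have K0 : 0 <= `|K| * D by rewrite mulr_ge0 // ltW.
have den0 : 0 < den by rewrite /den; lra.
set t := G * D / den.
have t0 : 0 < t by rewrite divr_gt0.
have tden : t * den = G * D by rewrite divfK // gt_eqF.
have tBK : t * (B ^+ 2 + K * D) <= G * D.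
  rewrite -tden ler_pM2l // /den.
  have : K * D <= `|K| * D by rewrite ler_pM2r // ler_norm.
  by lra.
exists t; split => //.
- by rewrite ler_pdivrMr // mul1r /den; lra.
- rewrite -(pmulr_lge0 _ D0).
  have : 0 <= t * B ^+ 2 by rewrite mulr_ge0 // ltW.
  by lra.
- have -> : (t * B) ^+ 2 = t * (t * B ^+ 2) by ring.
  have -> : (G - t * K) * (t * D) = t * (G * D - t * K * D) by ring.
  by rewrite ler_pM2l //; lra.
Qed.

Lemma form_symmetric (R : realType) (n : nat) (E : 'M[R]_n) (x y : 'rV[R]_n) :
  E^T = E -> x *m E *m y^T = y *m E *m x^T.
Proof.
move=> Esym; rewrite [LHS]mx11_scalar -[LHS]tr_scalar_mx -mx11_scalar.
by rewrite !trmx_mul trmxK Esym mulmxA.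
Qed.

Lemma form_expand (R : realType) (n : nat) (E : 'M[R]_n) (u w : 'rV[R]_n)
    (a b : R) :
  E^T = E ->
  ((a *: u + b *: w) *m E *m (a *: u + b *: w)^T) 0 0 =
    a ^+ 2 * (u *m E *m u^T) 0 0 + 2 * a * b * (u *m E *m w^T) 0 0
    + b ^+ 2 * (w *m E *m w^T) 0 0.
Proof.
move=> Esym.
have addE (A B : 'M[R]_1) : (A + B) 0 0 = A 0 0 + B 0 0 by rewrite mxE.
have scaleE (c : R) (A : 'M[R]_1) : (c *: A) 0 0 = c * A 0 0 by rewrite mxE.
rewrite linearD !linearZ /= !mulmxDl !mulmxDr -!scalemxAr -!scalemxAl.
by rewrite (form_symmetric w u Esym) !(addE, scaleE); ring.
Qed.

(* The gap [lam - mu] absorbs the cross terms [t * beta], which enter the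
   discriminant of the form on the plane only through [t ^+ 2]. *)
Lemma simple_minimiser_form (R : realType) (n : nat) (M M' : 'M[R]_n)
    (w : 'rV[R]_n) :
  (1 < n)%N -> simple_minimiser M -> inS M' ->
  w *m w^T = 1%:M -> w *m M = lambda n.-1 M *: w ->
  (w *m M *m w^T) 0 0 <= (w *m M' *m w^T) 0 0.
Proof.
move=> n1 [SM lt_lambda min_M] SM' ww wM; rewrite leNgt; apply/negP => form_lt.
have Msym := inS_sym SM.
have [u uM u0] : exists2 v : 'rV[R]_n, v *m M = lambda n M *: v & v != 0.
  case: n n1 M Msym {M' w SM lt_lambda min_M SM' ww wM form_lt} => // n _ M Msym.
  exact: lambda_eigenvector.
set lam := lambda n.-1 M in lt_lambda min_M wM.
set mu := lambda n M in lt_lambda uM.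
have uw : u *m w^T = 0.
  have : mu *: (u *m w^T) = lam *: (u *m w^T).
    rewrite !scalemxAl -uM (form_symmetric u w Msym) wM -!scalemxAl.
    by congr (_ *: _); rewrite -[w]mulmx1 form_symmetric ?trmx1 // !mulmx1.
  move/eqP; rewrite -subr_eq0 -scalerBl scaler_eq0 => /orP [|/eqP //].
  by rewrite subr_eq0 lt_eqF.
have wu : w *m u^T = 0 by apply: trmx_inj; rewrite trmx_mul trmxK uw trmx0.
set s := (u *m u^T) 0 0.
have s0 : 0 < s.
  have /rV0Pn [j uj] := u0.
  rewrite /s mxE (bigD1 j) //= ltr_pwDl ?mxE -?expr2 //.
    by rewrite exprn_even_gt0.
  by apply: sumr_ge0 => i _; rewrite mxE -expr2 sqr_ge0.
pose E := M' - M.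
have Esym : E^T = E by rewrite /E linearB /= !inS_sym.
set alpha := (u *m E *m u^T) 0 0; set beta := (u *m E *m w^T) 0 0.
set eps := - (w *m E *m w^T) 0 0.
have eps0 : 0 < eps.
  by rewrite /eps /E mulmxBr mulmxBl mxE [X in _ + X]mxE; lra.
(* At [a *: u + b *: w], the form of [lam - t * eps / 2] minus that of [M + t *: E] has coefficients
   [s * (lam - mu) - t * (s * eps / 2 + alpha)], [- 2 * t * beta] and [t * eps / 2]. Half of the
   first-order gain [eps] pays for the cross term; the other half is the decrease. *)
have [||t [t0 t1 A0 disc]] := @exists_small_step _ (s * (lam - mu)) (eps / 2)
    beta (s * eps / 2 + alpha).
- by rewrite mulr_gt0 // subr_gt0.
- by lra.
suff : lambda n.-1 (M + t *: E) <= lam - t * eps / 2.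
  apply/negP; rewrite -ltNge.
  apply: lt_le_trans (min_M _ (inS_convex _ SM SM')); last by rewrite ltW.
  by rewrite ltrBlDr ltrDl divr_gt0 // mulr_gt0.
apply: (@lambda_le_pair _ n _ u w) => //.
- by rewrite linearD linearZ /= Msym Esym.
- move=> a b ab.
  have /(congr1 (mulmx^~ u^T)) := ab; have /(congr1 (mulmx^~ w^T)) := ab.
  rewrite !mulmxDl -!scalemxAl uw wu ww !scaler0 addr0 add0r !mul0mx.
  move=> /matrixP /(_ 0 0); rewrite !mxE mulr1 => b0.
  move=> /matrixP /(_ 0 0); rewrite mxE -/s mxE => /eqP.
  by rewrite mulf_eq0 (gt_eqF s0) orbF => /eqP.
- move=> a b x xE.
  have xx : (x *m x^T) 0 0 = a ^+ 2 * s + b ^+ 2.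
    rewrite xE -[X in X *m _]mulmx1 form_expand ?trmx1 //.
    by rewrite !mulmx1 uw ww -/s !mxE eqxx mulr1n; ring.
  have xMx : (x *m M *m x^T) 0 0 = a ^+ 2 * (mu * s) + b ^+ 2 * lam.
    rewrite xE form_expand // uM wM -!scalemxAl uw ww !scaler0.
    by rewrite [X in _ * X + _ + _]mxE -/s !mxE eqxx mulr1n; ring.
  have xEx := form_expand u w a b Esym.
  rewrite -xE -/alpha -/beta in xEx.
  rewrite mulmxDr mulmxDl -scalemxAr -scalemxAl mxE [X in _ + X]mxE xMx xEx xx.
  have := quad_form_ge0 a b A0 (_ : 0 < t * (eps / 2)) disc.
  have -> : 0 < t * (eps / 2) by rewrite mulr_gt0 //; lra.
  by move=> /(_ isT); rewrite /eps; lra.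
Qed.

(** * Entries forced by the signs of the eigenvector *)

Lemma form_sum (R : realType) (n : nat) (M : 'M[R]_n) (x : 'rV[R]_n) :
  (x *m M *m x^T) 0 0 = \sum_i \sum_j M i j * (x 0 i * x 0 j).
Proof.
rewrite mxE exchange_big; apply: eq_bigr => j _ /=.
rewrite !mxE mulr_suml; apply: eq_bigr => i _; ring.
Qed.

(** The 0/1 matrix [M'] minimises the form at [w] entry by entry, so each term of the difference is
    nonnegative; optimality of [M] makes their sum at most zero, hence every term vanishes. *)
Lemma simple_minimiser_entries (R : realType) (n : nat) (M : 'M[R]_n)
    (w : 'rV[R]_n) i j :
  (1 < n)%N -> simple_minimiser M ->
  w *m w^T = 1%:M -> w *m M = lambda n.-1 M *: w ->
  w 0 i * w 0 j != 0 -> M i j = (w 0 i * w 0 j < 0)%R%:R.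
Proof.
move=> n1 minM ww wM wij.
pose M' : 'M[R]_n := \matrix_(k, l) (w 0 k * w 0 l < 0)%R%:R.
have SM : inS M by case: minM.
have SM' : inS M'.
  apply: inSP => [|k l]; first by apply/matrixP => k l; rewrite !mxE mulrC.
  by rewrite mxE; case: (_ < 0); rewrite lexx ler01.
have term_ge0 k l : 0 <= (M k l - M' k l) * (w 0 k * w 0 l).
  have /andP [M0 M1] := inS_bounds k l SM; rewrite mxE.
  by have [w_lt0|w_ge0] := ltrP; rewrite /=; nra.
have := simple_minimiser_form n1 minM SM' ww wM.
rewrite !form_sum -subr_le0 -sumrB.
under eq_bigr do rewrite -sumrB.
under eq_bigr do under eq_bigr do rewrite -mulrBl.
move=> sum_le0.
have sum_ge0 k : 0 <= \sum_l (M k l - M' k l) * (w 0 k * w 0 l).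
  by apply: sumr_ge0.
have /eqP/psumr_eq0P sum0 :
    \sum_k \sum_l (M k l - M' k l) * (w 0 k * w 0 l) == 0.
  by rewrite eq_le sum_le0 sumr_ge0.
have /psumr_eq0P /(_ j isT) /eqP := sum0 (fun k _ => sum_ge0 k) i isT.
rewrite mulf_eq0 (negPf wij) orbF subr_eq0 mxE => /(_ _)/eqP; apply.
by move=> l _; apply: term_ge0.
Qed.

(** * Values of the eigenvector and of the eigenvalue *)

(** The two linear equations are the eigenvector equation at a positive and at a negative index.
    Multiplied by [q] and [p] respectively, they give [P * p ^+ 2 = N * q ^+ 2], so each is one
    half; their product gives [P * N = lam ^+ 2]. *)
Lemma two_level_eigen (R : realType) (P N p q lam : R) :
  0 < P -> 0 < N -> 0 < p -> 0 < q -> lam < 0 ->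
  - (N * q) = lam * p -> P * p = lam * - q ->
  P * p ^+ 2 + N * q ^+ 2 = 1 ->
  [/\ p = (Num.sqrt (2 * P))^-1, q = (Num.sqrt (2 * N))^-1 &
      lam = - Num.sqrt (P * N)].
Proof.
move=> P0 N0 p0 q0 lam0 eq_p eq_q norm1.
have eN : N * q = - (lam * p) by rewrite -eq_p opprK.
have half : P * p ^+ 2 = N * q ^+ 2.
  have -> : P * p ^+ 2 = P * p * p by ring.
  have -> : N * q ^+ 2 = N * q * q by ring.
  by rewrite eq_q eN; ring.
have sqrt_inv (A x : R) : 0 < A -> 0 < x -> A * x ^+ 2 + A * x ^+ 2 = 1 ->
    x = (Num.sqrt (2 * A))^-1.
  move=> A0 x0 Ax; have -> : 2 * A = (x^-1) ^+ 2.
    rewrite exprVn; apply: (mulIf (lt0r_neq0 (exprn_gt0 2 x0))).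
    by rewrite mulVf ?lt0r_neq0 ?exprn_gt0 // -mulrA mulr_natl mulr2n.
  by rewrite sqrtr_sqr gtr0_norm ?invr_gt0 // invrK.
split.
- by apply: sqrt_inv => //; rewrite {2}half.
- by apply: sqrt_inv => //; rewrite -{1}half.
have -> : P * N = lam ^+ 2.
  apply: (mulIf (lt0r_neq0 (mulr_gt0 p0 q0))).
  have -> : P * N * (p * q) = P * p * (N * q) by ring.
  by rewrite eq_q eN; ring.
by rewrite sqrtr_sqr ltr0_norm ?opprK.
Qed.

Lemma sum_sign_split (R : realType) (n : nat) (v F : 'I_n -> R) :
  (forall j, v j = 0 -> F j = 0) ->
  \sum_j F j = \sum_(j in [set j | 0 < v j]) F j +
               \sum_(j in [set j | v j < 0]) F j.
Proof.
move=> F0; rewrite (bigID (mem [set j | 0 < v j])) /=; congr (_ + _).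
rewrite (bigID (mem [set j | v j < 0])) /= [X in _ + X]big1 ?addr0.
  by apply: eq_bigl => j; rewrite !inE; case: (ltrgt0P (v j)).
move=> j; rewrite !inE => /andP [v1 v2]; apply: F0.
by move: v1 v2; case: (ltrgt0P (v j)).
Qed.

(** For [i] in [A] the forced entries reduce row [i] of the eigenvector equation to the sum of [v]
    over [B], which does not depend on [i]; so [v] is constant on [A], and likewise on [B]. A row
    with [v i = 0] gives the balance identity. *)
Lemma simple_minimiser_levels (R : realType) (n : nat) (M : 'M[R]_n)
    (w : 'rV[R]_n) (v := w 0) (A := [set i | 0 < v i]) (B := [set i | v i < 0])
    (p := (Num.sqrt (2 * #|A|%:R))^-1) (q := (Num.sqrt (2 * #|B|%:R))^-1) :
  (1 < n)%N -> simple_minimiser M ->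
  w *m w^T = 1%:M -> w *m M = lambda n.-1 M *: w ->
  [/\ (0 < #|A|)%N /\ (0 < #|B|)%N,
      lambda n.-1 M = - Num.sqrt (#|A|%:R * #|B|%:R),
      forall i, i \in A -> v i = p,
      forall i, i \in B -> v i = - q &
      forall i, v i = 0 ->
        p * \sum_(j in A) M i j = q * \sum_(j in B) M i j].
Proof.
move=> n1 minM ww wM; have lam_lt0 := simple_minimiser_lt0 n1 minM.
have entries i j := @simple_minimiser_entries _ _ _ _ i j n1 minM ww wM.
have Msym : M^T = M by case: minM => /inS_sym.
set lam := lambda _ _ in wM lam_lt0 *.
have eigen i : \sum_(j in A) M i j * v j + \sum_(j in B) M i j * v j = lam * v i.
  have /rowP /(_ i) := wM; rewrite !mxE => <-.
  rewrite -sum_sign_split; last by move=> j ->; rewrite mulr0.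
  by apply: eq_bigr => j _; rewrite mulrC -{1}Msym mxE.
pose a := \sum_(j in A) v j; pose b := \sum_(j in B) v j.
have eigenA i : i \in A -> b = lam * v i.
  rewrite inE => vi; rewrite -eigen [X in X + _]big1 ?add0r.
    apply: eq_bigr => j; rewrite inE => vj.
    have ij : w 0 i * w 0 j < 0 by rewrite pmulr_rlt0.
    by rewrite entries ?lt_eqF // ij mul1r.
  move=> j; rewrite inE => vj.
  have ij : 0 < w 0 i * w 0 j by rewrite mulr_gt0.
  by rewrite entries ?gt_eqF // ltNge ltW // mul0r.
have eigenB i : i \in B -> a = lam * v i.
  rewrite inE => vi; rewrite -eigen [X in _ + X]big1 ?addr0.
    apply: eq_bigr => j; rewrite inE => vj.
    have ij : w 0 i * w 0 j < 0 by rewrite pmulr_llt0.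
    by rewrite entries ?lt_eqF // ij mul1r.
  move=> j; rewrite inE => vj.
  have ij : 0 < w 0 i * w 0 j by rewrite nmulr_rgt0.
  by rewrite entries ?gt_eqF // ltNge ltW // mul0r.
(* If only one sign occurred, the sum over the other set would be zero, against [lam * v i != 0];
   some sign occurs because [w] is nonzero. *)
have nonempty : A != set0 /\ B != set0.
  have BA : A != set0 -> B != set0.
    case/set0Pn => i Ai; apply/eqP => B0; have := eigenA i Ai.
    rewrite /b B0 big_set0 => /esym/eqP; rewrite mulf_eq0 lt_eqF //=.
    by move: Ai; rewrite inE => /gt_eqF ->.
  have AB : B != set0 -> A != set0.
    case/set0Pn => i Bi; apply/eqP => A0; have := eigenB i Bi.
    rewrite /a A0 big_set0 => /esym/eqP; rewrite mulf_eq0 lt_eqF //=.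
    by move: Bi; rewrite inE => /lt_eqF ->.
  have : w != 0.
    apply: contra_eq_neq ww => ->; rewrite mul0mx eq_sym.
    by apply/matrix0Pn; exists 0, 0; rewrite mxE oner_eq0.
  case/rV0Pn => i; rewrite neq_lt => /orP [vi|vi].
    have Bi : B != set0 by apply/set0Pn; exists i; rewrite inE.
    by split; first exact: AB.
  have Ai : A != set0 by apply/set0Pn; exists i; rewrite inE.
  by split; last exact: BA.
have lam0 : lam != 0 by rewrite lt_eqF.
pose x := b / lam; pose y := - (a / lam).
have vA i : i \in A -> v i = x by move=> /eigenA bE; rewrite /x bE mulrC mulKf.
have vB i : i \in B -> v i = - y.
  by move=> /eigenB aE; rewrite /y opprK aE mulrC mulKf.
have [[i0 Ai0] [j0 Bj0]] : (exists i, i \in A) /\ (exists j, j \in B).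
  by split; apply/set0Pn; case: nonempty.
have x0 : 0 < x by rewrite -(vA i0) //; move: Ai0; rewrite inE.
have y0 : 0 < y by rewrite -oppr_lt0 -(vB j0) //; move: Bj0; rewrite inE.
have aE : a = #|A|%:R * x.
  by rewrite /a (eq_bigr _ vA) sumr_const mulr_natl.
have bE : b = - (#|B|%:R * y).
  by rewrite /b (eq_bigr _ vB) sumr_const mulNrn mulr_natl.
have A0 : (0 < #|A|)%N by rewrite card_gt0; case: nonempty.
have B0 : (0 < #|B|)%N by rewrite card_gt0; case: nonempty.
have norm1 : #|A|%:R * x ^+ 2 + #|B|%:R * y ^+ 2 = 1 :> R.
  have /matrixP /(_ 0 0) := ww; rewrite mxE [RHS]mxE eqxx mulr1n => ww1.
  rewrite -[RHS]ww1.
  under [RHS]eq_bigr do rewrite mxE.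
  rewrite (@sum_sign_split _ _ v); last by move=> j; rewrite /v => ->; rewrite mul0r.
  congr (_ + _).
    rewrite mulr_natl -sumr_const; apply: eq_bigr => j /vA vj.
    by rewrite -/(v j) vj expr2.
  rewrite mulr_natl -sumr_const; apply: eq_bigr => j /vB vj.
  by rewrite -/(v j) vj mulrNN expr2.
have [] := @two_level_eigen R #|A|%:R #|B|%:R x y lam; rewrite ?ltr0n //.
- by rewrite -bE -(vA i0) //; apply: eigenA.
- by rewrite -aE -(vB j0) //; apply: eigenB.
rewrite -/p -/q => xp yq lamE; split => //.
- by rewrite -xp.
- by rewrite -yq.
move=> i vi; have := eigen i; rewrite vi mulr0 => /eqP.
rewrite (eq_bigr (fun j => M i j * x)); last by move=> j /vA ->.
rewrite [X in _ + X](eq_bigr (fun j => M i j * - y)); last by move=> j /vB ->.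
rewrite -!mulr_suml mulrN subr_eq0 -xp -yq => /eqP.
by rewrite mulrC => ->; rewrite mulrC.
Qed.

(** * Block form after a permutation *)

(** Indices are listed as [A], then [B], then the rest. The block sizes sum to [n] only
    propositionally, so [e] is returned for the casts. *)
Lemma partition_perm (n : nat) (A B : {set 'I_n}) (C := ~: (A :|: B)) :
  [disjoint A & B] ->
  exists (s : 'S_n) (e : (#|A| + #|B| + #|C|)%N = n),
    [/\ forall k : 'I_#|A|,
          s (cast_ord e (lshift #|C| (lshift #|B| k))) = enum_val k,
        forall k : 'I_#|B|,
          s (cast_ord e (lshift #|C| (rshift #|A| k))) = enum_val k &
        forall k : 'I_#|C|,
          s (cast_ord e (rshift (#|A| + #|B|) k)) = enum_val k].
Proof.
move=> dAB.
have e : (#|A| + #|B| + #|C|)%N = n.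
  have /eqP <- : #|A :|: B| == (#|A| + #|B|)%N.
    by rewrite (leq_card_setU A B).2.
  by rewrite cardsC card_ord.
pose g (i : 'I_(#|A| + #|B| + #|C|)) : 'I_n :=
  match split i with
  | inl j => match split j with inl k => enum_val k | inr k => enum_val k end
  | inr k => enum_val k
  end.
have gA k : g (lshift _ (lshift _ k)) = enum_val k.
  by rewrite /g !(unsplitK (inl _)).
have gB k : g (lshift _ (rshift _ k)) = enum_val k.
  by rewrite /g (unsplitK (inl _)) (unsplitK (inr _)).
have gC k : g (rshift _ k) = enum_val k by rewrite /g (unsplitK (inr _)).
have g_onto i : exists j, g j = i.
  have [Ai|nAi] := boolP (i \in A).
    by exists (lshift _ (lshift _ (enum_rank_in Ai i))); rewrite gA enum_rankK_in.
  have [Bi|nBi] := boolP (i \in B).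
    by exists (lshift _ (rshift _ (enum_rank_in Bi i))); rewrite gB enum_rankK_in.
  have Ci : i \in C by rewrite !inE negb_or nAi.
  by exists (rshift _ (enum_rank_in Ci i)); rewrite gC enum_rankK_in.
(* Since [g] is onto, it has a right inverse [h]; between types of equal size [h] is bijective, so
   [g] is its inverse. *)
have g_inj : injective (g \o cast_ord (esym e)).
  have /fin_all_exists [h hK] := g_onto.
  have hK' : cancel (cast_ord e \o h) (g \o cast_ord (esym e)).
    by move=> i /=; rewrite cast_ordK hK.
  exact: bij_inj (bij_can_bij (injF_bij (can_inj hK')) hK').
exists (perm g_inj), e.
by split=> k; rewrite permE /= cast_ordK.
Qed.

Theorem theorem4p5 (R : realType) (n : nat) (M : 'M[R]_n) (w : 'cV[R]_n) :
  (2 <= n)%N ->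
  simple_minimiser M ->
  w^T *m w = 1%:M ->
  M *m w = lambda n.-1 M *: w ->
  exists (s : 'S_n) (P N Z : nat) (e : (P + N + Z)%N = n)
         (X : 'M[R]_(P, Z)) (Y : 'M[R]_(N, Z)) (W : 'M[R]_Z),
    [/\ (1 <= P)%N, (1 <= N)%N,
        [forall i, forall j, (0 <= X i j) && (X i j <= 1)],
        [forall i, forall j, (0 <= Y i j) && (Y i j <= 1)] &
        [forall i, forall j, (0 <= W i j) && (W i j <= 1)]] /\
    [/\
        (Num.sqrt (P%:R))^-1 *: (X^T *m const_mx 1) =
          (Num.sqrt (N%:R))^-1 *: (Y^T *m const_mx 1 : 'cV[R]_Z),
        (\matrix_(i, j) M (s i) (s j)) =
          castmx (e, e)
            (block_mx (block_mx (0 : 'M[R]_P) (const_mx 1) (const_mx 1) (0 : 'M[R]_N))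
                      (col_mx X Y) (row_mx X^T Y^T) W),
        (\col_i w (s i) 0) =
          castmx (e, erefl 1%N)
            (col_mx (col_mx (const_mx (Num.sqrt (2 * P%:R))^-1 : 'cV[R]_P)
                            (const_mx (- (Num.sqrt (2 * N%:R))^-1) : 'cV[R]_N))
                    (0 : 'cV[R]_Z))
      & lambda n.-1 M = - Num.sqrt (P%:R * N%:R)].
Proof.
move=> n1 minM ww Mw; have SM : inS M by case: minM.
have Msym := inS_sym SM.
(* The lemmas use row vectors; symmetry of [M] turns the column eigenvector into a row one. *)
have ww' : w^T *m w^T^T = 1%:M by rewrite trmxK.
have wM' : w^T *m M = lambda n.-1 M *: w^T.
  by apply: trmx_inj; rewrite trmx_mul trmxK Msym Mw linearZ /= trmxK.
have [[P0 N0] lamE vA vB vC] := simple_minimiser_levels n1 minM ww' wM'.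
have entries i j := @simple_minimiser_entries _ _ _ _ i j n1 minM ww' wM'.
have entries_pos i j : 0 < w^T 0 i * w^T 0 j -> M i j = 0.
  by move=> ij; rewrite entries ?gt_eqF // ltNge ltW.
have entries_neg i j : w^T 0 i * w^T 0 j < 0 -> M i j = 1.
  by move=> ij; rewrite entries ?lt_eqF // ij.
set A := [set i | _] in P0 lamE vA vC; set B := [set i | _] in N0 lamE vB vC.
have dAB : [disjoint A & B].
  by apply/pred0P => i /=; rewrite !inE; case: ltrgt0P.
have [s [e [sA sB sC]]] := partition_perm dAB.
set C := ~: (A :|: B) in e sA sB sC.
have MM i j : M j i = M i j by rewrite -{1}Msym mxE.
have wE i : w i 0 = w^T 0 i by rewrite mxE.
have C0 (k : 'I_#|C|) : w^T 0 (enum_val k) = 0.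
  by have := enum_valP k; rewrite !inE; case: ltrgt0P.
have Agt0 (k : 'I_#|A|) : 0 < w^T 0 (enum_val k).
  by have := enum_valP k; rewrite inE.
have Blt0 (k : 'I_#|B|) : w^T 0 (enum_val k) < 0.
  by have := enum_valP k; rewrite inE.
exists s, #|A|, #|B|, #|C|, e.
(* The index types alone tell the three witnesses apart: rows in [A], [B] and [C] for [X], [Y] and
   [W], columns always in [C]. *)
exists (\matrix_(i, j) M (enum_val i) (enum_val j)).
exists (\matrix_(i, j) M (enum_val i) (enum_val j)).
exists (\matrix_(i, j) M (enum_val i) (enum_val j)).
split.
  by split => //; apply/forallP => i; apply/forallP => j; rewrite mxE inS_bounds.
split => //.
- apply/colP => k; rewrite !mxE.
  under eq_bigr do rewrite !mxE mulr1 MM.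
  under [in RHS]eq_bigr do rewrite !mxE mulr1 MM.
  (* This is the required identity with an extra factor [(Num.sqrt 2)^-1] on both sides, cancelled
     at the end. *)
  have := vC _ (C0 k).
  rewrite [\sum_(j in A) _]big_enum_val [\sum_(j in B) _]big_enum_val /=.
  rewrite !sqrtrM // !invfM -!mulrA.
  by apply: mulfI; rewrite invr_eq0 sqrtr_eq0 -ltNge.
- apply/matrixP => i j; rewrite -(cast_ordKV e i) -(cast_ordKV e j).
  rewrite castmxE mxE !cast_ordK.
  case: (split_ordP (cast_ord (esym e) i)) => [i' ->|i' ->];
  case: (split_ordP (cast_ord (esym e) j)) => [j' ->|j' ->];
  rewrite ?(block_mxEul, block_mxEur, block_mxEdl, block_mxEdr).
  (* Equal signs give the zero blocks, opposite signs the all-ones blocks. *)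
  + case: (split_ordP i') => [i'' ->|i'' ->];
    case: (split_ordP j') => [j'' ->|j'' ->];
    rewrite ?(block_mxEul, block_mxEur, block_mxEdl, block_mxEdr) ?sA ?sB !mxE.
    * by apply: entries_pos; rewrite mulr_gt0.
    * by apply: entries_neg; rewrite pmulr_rlt0.
    * by apply: entries_neg; rewrite pmulr_llt0.
    * by apply: entries_pos; rewrite nmulr_rgt0.
  + case: (split_ordP i') => [i'' ->|i'' ->];
    by rewrite ?(col_mxEu, col_mxEd) ?sA ?sB sC !mxE.
  + case: (split_ordP j') => [j'' ->|j'' ->];
    by rewrite ?(row_mxEl, row_mxEr) ?sA ?sB sC !mxE.
  + by rewrite !sC mxE.
- apply/matrixP => i j; rewrite -(cast_ordKV e i) castmxE mxE cast_ordK cast_ord_id.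
  case: (split_ordP (cast_ord (esym e) i)) => [i' ->|i' ->].
    rewrite col_mxEu; case: (split_ordP i') => [i'' ->|i'' ->].
    + by rewrite sA col_mxEu mxE wE vA ?enum_valP.
    + by rewrite sB col_mxEd mxE wE vB ?enum_valP.
  by rewrite col_mxEd sC mxE wE C0.
Qed.
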